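(* Let $P$ be a complex polynomial of degree $d\ge2$ with connected Julia set $J_P$, let $\varphi$ be the finest monotone map of $J_P$ (extended canonically to the plane) semiconjugating $P$ to the topological polynomial $g$, and let $J_{\sim_P}=\varphi(J_P)$. Then the map $\Phi=\varphi\circ\mathrm{imp}:S^1\to J_{\sim_P}$ semiconjugates $\sigma_d:z\mapsto z^d$ on $S^1$ to $g|_{J_{\sim_P}}$, i.e. $g\circ\Phi=\Phi\circ\sigma_d$.
   Context: The finest monotone map of $J_P$ is the monotone (continuous, connected fibers) surjection onto a locally connected continuum through which every other such surjection factors monotonically; it is extended to the plane by collapsing topological hulls of its fibers and being a homeomorphism elsewhere, and there is a branched covering map $g$ of the plane with $\varphi\circ P=g\circ\varphi$. Let $\Psi:\widehat{\mathbb{C}}\setminus\overline{\mathbb{D}}\to U_\infty(P)\cup\{\infty\}$ be the Böttcher map; $\mathrm{imp}(\alpha)$ for $e^{2\pi i\alpha}\in S^1$ is the set of all limits $\lim\Psi(z_i)$, $|z_i|>1$, $z_i\to e^{2\pi i\alpha}$. Since $\varphi$ collapses each impression to a point, $\Phi(\alpha)=\varphi(\mathrm{imp}(\alpha))$ is a well-defined continuous function. *)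

(* Defs.v *)
(* The complex plane is R[i] = complex R
   (mathcomp-real-closed) for R : realType, equipped below with its normed
   (Euclidean) topology, viewing R[i] as a normed module over itself, so that
   [derivable f z 1] is complex differentiability. *)
From HB Require Import structures.
From mathcomp Require Import all_boot all_order all_algebra.
From mathcomp Require Import all_classical all_reals all_analysis.
From mathcomp.real_closed Require Export complex.
Import Order.TTheory GRing.Theory Num.Theory.
Import numFieldNormedType.Exports.

Set Implicit Arguments.
Unset Strict Implicit.
Unset Printing Implicit Defensive.

Local Open Scope classical_set_scope.
Local Open Scope ring_scope.

HB.instance Definition _ (R : rcfType) := NormedModule.copy R[i] (R[i])^o.
HB.instance Definition _ (R : rcfType) := GRing.ComAlgebra.copy R[i] (R[i])^o.

Section Dynamics.
Context {R : realType}.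
Local Notation C := (R[i]).

Definition bnd (S : set C) := exists M : C, forall w, S w -> `|w| <= M.

Definition filled_julia (P : {poly C}) : set C :=
  [set z | exists M : C, forall n, `|iter n (horner P) z| <= M].

Definition julia (P : {poly C}) : set C :=
  closure (filled_julia P) `\` interior (filled_julia P).

Definition basin (P : {poly C}) : set C := ~` filled_julia P.

Definition ext_disk : set C := [set z | 1 < `|z|].

Definition bottcher (P : {poly C}) (Psi : C -> C) :=
  [/\ (forall z, ext_disk z -> derivable Psi z 1),
      (forall z, ext_disk z -> basin P (Psi z)),
      (forall z1 z2, ext_disk z1 -> ext_disk z2 -> Psi z1 = Psi z2 -> z1 = z2),
      (forall w, basin P w -> exists2 z, ext_disk z & Psi z = w) &
      (forall z, ext_disk z -> Psi (z ^+ (size P).-1) = P.[Psi z])].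

Definition imp (Psi : C -> C) (zeta : C) : set C :=
  [set w | exists u : nat -> C,
      [/\ (forall n, ext_disk (u n)), u @ \oo --> zeta & (Psi \o u) @ \oo --> w]].

Definition Phi (phi Psi : C -> C) (zeta : C) : set C := phi @` imp Psi zeta.

End Dynamics.

Section Topology.

Definition continuum {Y : topologicalType} (X : set Y) :=
  [/\ X !=set0, compact X & connected X].

Definition locally_connected_set {Y : topologicalType} (X : set Y) :=
  forall x, X x -> forall U, nbhs x U ->
    exists V, [/\ open V, V x, connected (V `&` X) & V `&` X `<=` U].

Definition monotone_onto {X Y : topologicalType} (A : set X) (f : X -> Y)
  (B : set Y) :=
  [/\ f @` A = B, {within A, continuous f} &
      forall y, B y -> connected (A `&` f @^-1` [set y])].

Definition lc_monotone {X Y : topologicalType} (A : set X) (f : X -> Y) :=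
  [/\ monotone_onto A f (f @` A), continuum (f @` A) &
      locally_connected_set (f @` A)].

Definition finest_monotone {X Z : topologicalType} (J : set X) (phi : X -> Z) :=
  lc_monotone J phi /\
  forall (Y : topologicalType), hausdorff_space Y ->
  forall psi : X -> Y, lc_monotone J psi ->
    exists h : Z -> Y,
      monotone_onto (phi @` J) h (psi @` J) /\
      forall x, J x -> psi x = h (phi x).

End Topology.

Section Plane.
Context {R : realType}.
Local Notation C := (R[i]).

Definition hull (A : set C) : set C :=
  [set z | ~ ((~` A) z /\ ~ bnd (connected_component (~` A) z))].

Definition hulls_of_fibres (J : set C) (phi : C -> C) : set C :=
  [set w | exists2 z, J z & hull (J `&` phi @^-1` [set phi z]) w].

Definition homeo_onto (h : C -> C) (U D : set C) :=
  [/\ {within U, continuous h}, h @` U = D &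
      exists h' : C -> C, {within D, continuous h'} /\
        forall x, U x -> h' (h x) = x].

Definition plane_extension (J : set C) (phi : C -> C) :=
  let T := hulls_of_fibres J phi in
  [/\ continuous phi, (forall w, exists z, phi z = w) &
      (forall z w, J z -> hull (J `&` phi @^-1` [set phi z]) w -> phi w = phi z)] /\
  [/\ (forall z1 z2, (~` T) z1 -> (~` T) z2 -> phi z1 = phi z2 -> z1 = z2),
      (forall z w, (~` T) z -> T w -> phi z <> phi w) &
      homeo_onto phi (~` T) (phi @` (~` T))].

Definition unit_disk : set C := [set w | `|w| < 1].

Definition branched_covering (g : C -> C) :=
  [/\ continuous g,
      (forall A, compact A -> compact (g @^-1` A)) &
      forall z, exists k : nat, exists U V : set C, exists h1 h2 : C -> C,
        [/\ (0 < k)%N, open U, U z, open V & V (g z)] /\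
        [/\ homeo_onto h1 U unit_disk, homeo_onto h2 V unit_disk,
            h1 z = 0, h2 (g z) = 0 &
            forall w, U w -> V (g w) /\ h2 (g w) = h1 w ^+ k]].

End Plane.

(* Main.v *)
(* Since [g (phi z) = phi P.[z]], everything reduces to two facts about
   impressions, with [d] the degree of [P].

   First, [P] maps [imp zeta] onto [imp (zeta ^ d)].  If [v n --> zeta ^ d] and
   [Psi (v n) --> w], choose [u n] with [u n ^ d = v n] and [u n --> zeta]; then
   [P (Psi (u n)) = Psi (v n) --> w], so a subsequence of [Psi (u n)] converges
   to a root of [P - w].

   Second, [imp zeta] lies in the Julia set.  A limit of basin points is not
   interior to the filled Julia set.  Moreover [P^k (Psi (u n))] equals
   [Psi (u n ^ (d ^ k))], where [u n ^ (d ^ k)] tends to the unit circle, and [Psi] is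
   bounded on [1 < |z| <= 2]; hence the orbit of the limit is bounded. *)
Require Import Defs.
From HB Require Import structures.
From mathcomp Require Import all_boot all_order all_algebra.
From mathcomp Require Import all_classical all_reals all_analysis.
From mathcomp.real_closed Require Import complex.
From mathcomp Require Import ring.
Import Order.TTheory GRing.Theory Num.Theory.
Import numFieldNormedType.Exports.
Local Open Scope classical_set_scope.
Local Open Scope ring_scope.

(** * Limits of sequences and of polynomial values *)

Lemma cvg_seqP (K : numFieldType) (u : nat -> K) (l : K) :
  u @ \oo --> l <->
  forall e, 0 < e -> exists N, forall n, (N <= n)%N -> `|u n - l| < e.
Proof.
split=> [/cvgrPdistC_lt ul e /ul[N _ H]|H].
  by exists N => n Nn; exact: (H n Nn).
by apply/cvgrPdistC_lt => e /H[N {}H]; exists N => // n Nn; exact: (H n Nn).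
Qed.

Lemma poly_bounded (K : numFieldType) (p : {poly K}) (M : K) :
  exists2 B, 0 <= B & forall x, `|x| <= M -> `|p.[x]| <= B.
Proof.
elim/poly_ind: p => [|p c [B B0 IH]].
  by exists 0 => // x _; rewrite horner0 normr0.
exists (B * `|M| + `|c|) => [|x xM]; first by rewrite addr_ge0 ?mulr_ge0.
rewrite hornerMXaddC (le_trans (ler_normD _ _))// lerD2r normrM ler_pM ?IH//.
by rewrite (le_trans xM)// real_ler_norm// ger0_real// (le_trans _ xM).
Qed.

(** By the factor theorem [p - p.[l]] is [q] times ['X - l], and [q] is bounded on the disk of
    radius [|l| + 1], where the tail of [u] lies. *)
Lemma horner_cvg (K : numFieldType) (p : {poly K}) (u : nat -> K) (l : K) :
  u @ \oo --> l -> (horner p \o u) @ \oo --> p.[l].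
Proof.
move=> /cvg_seqP ul; apply/cvg_seqP => e e0.
have /factor_theorem[q pq] : root (p - p.[l]%:P) l by rewrite /root !hornerE subrr.
have [B B0 qB] := poly_bounded _ q (`|l| + 1).
have B1 : 0 < B + 1 by rewrite ltr_wpDl.
have [N1 H1] := ul _ ltr01; have [N2 H2] := ul _ (divr_gt0 e0 B1).
exists (maxn N1 N2) => n; rewrite geq_max => /andP[n1 n2] /=.
have -> : p.[u n] - p.[l] = q.[u n] * (u n - l).
  by have /(congr1 (horner^~ (u n))) := pq; rewrite !hornerE.
have qun : `|q.[u n]| <= B + 1.
  rewrite (le_trans (qB _ _)) ?lerDl//.
  by rewrite -[u n](subrK l) addrC (le_trans (ler_normD _ _))// lerD2l ltW ?H1.
rewrite normrM (le_lt_trans (ler_wpM2r _ qun))//.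
by rewrite mulrC -ltr_pdivlMr// H2.
Qed.

Lemma iter_horner_cvg (K : numFieldType) (p : {poly K}) (u : nat -> K) (l : K) k :
  u @ \oo --> l ->
  (fun n => iter k (horner p) (u n)) @ \oo --> iter k (horner p) l.
Proof. by move=> ul; elim: k => //= k; exact: horner_cvg. Qed.

(** Since [s] need not be increasing, the indices of a subsequence can be chosen independently of
    one another. *)
Lemma cvg_reindex (K : numFieldType) (u : nat -> K) (l : K) (s : nat -> nat) :
  (forall n, (n <= s n)%N) -> u @ \oo --> l -> (u \o s) @ \oo --> l.
Proof.
move=> ns /cvg_seqP ul; apply/cvg_seqP => e /ul[N H]; exists N => n Nn.
exact/H/(leq_trans Nn).
Qed.

Lemma cvg_norm_le (K : numFieldType) (u : nat -> K) (l M : K) :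
  u @ \oo --> l -> 0 <= M ->
  (exists N, forall n, (N <= n)%N -> `|u n| <= M) -> `|l| <= M.
Proof.
move=> /cvg_seqP ul M0 [N uM].
have [//|lM] := real_leP (normr_real l) (ger0_real M0).
have /ul[N' H] : 0 < `|l| - M by rewrite subr_gt0.
have := H _ (leq_maxr N N'); have := uM _ (leq_maxl N N').
set z := u _ => zM; rewrite distrC => lz.
have := le_lt_trans (lerB_dist l z) lz.
by rewrite ltrD2l ltrN2 => /lt_le_trans/(_ zM); rewrite ltxx.
Qed.

(** Turns a bound on the [d]-th power of a distance, which is what choosing a nearest root gives,
    into convergence. *)
Lemma cvg_expn_dist (K : numFieldType) (d : nat) (c l m : K) (a b : nat -> K) :
  0 < c -> (forall n, c * `|a n - l| ^+ d <= `|b n - m|) ->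
  b @ \oo --> m -> a @ \oo --> l.
Proof.
move=> c0 ab /cvg_seqP bm; apply/cvg_seqP => e e0.
have [N H] := bm _ (mulr_gt0 c0 (exprn_gt0 d e0)); exists N => n Nn.
have [//|ea] := real_ltP (normr_real (a n - l)) (gtr0_real e0).
have := le_lt_trans (ab n) (H n Nn).
have ead : e ^+ d <= `|a n - l| ^+ d by rewrite lerXn2r ?nnegrE// ltW.
by rewrite ltr_pM2l// => /lt_le_trans/(_ ead); rewrite ltxx.
Qed.

(** * Nearby roots and a pigeonhole principle *)

Lemma exp_min_dist_le_prod (K : numDomainType) (x : K) (s : seq K) : s != [::] ->
  exists2 r, r \in s & `|x - r| ^+ size s <= \prod_(y <- s) `|x - y|.
Proof.
elim: s => //= y [_ _|z s /(_ isT)[r rs IH] _].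
  by exists y; rewrite ?mem_head// big_seq1.
(* Keep whichever of [y] and [r] is nearer to [x]. *)
rewrite big_cons; have [yr|ry] := real_leP (normr_real (x - y)) (normr_real (x - r)).
  exists y; first by rewrite mem_head.
  rewrite exprS ler_wpM2l// (le_trans _ IH)// lerXn2r ?nnegrE//.
exists r; first by rewrite inE rs orbT.
by rewrite exprS ler_pM ?exprn_ge0// ltW.
Qed.

(* If [|x - r|] is least among the roots, then [|p.[x]|], a product over all
   roots, is at least [|lead_coef p| * |x - r| ^ deg p]. *)
Lemma root_near (K : numClosedFieldType) (p : {poly K}) (x : K) : (1 < size p)%N ->
  exists2 r, root p r & `|lead_coef p| * `|x - r| ^+ (size p).-1 <= `|p.[x]|.
Proof.
move=> p1; have [s ps] := closed_field_poly_normal p.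
have lp : lead_coef p != 0 by rewrite lead_coef_eq0 -size_poly_gt0 ltnW.
have sp : size p = (size s).+1 by rewrite {1}ps size_scale// size_prod_XsubC.
have [|r rs H] := exp_min_dist_le_prod _ x s; first by move: p1; rewrite sp; case: (s).
exists r; first by rewrite ps rootZ// root_prod_XsubC.
rewrite {3}ps hornerZ normrM sp /= ler_wpM2l// (le_trans H)//.
rewrite horner_prod normr_prod; apply: ler_prod => y _ //.
by rewrite !hornerE lexx normr_ge0.
Qed.

Lemma infinite_pigeonhole (T : eqType) (s : seq T) (f : nat -> T) :
  (forall n, f n \in s) ->
  exists2 r, r \in s & forall N, exists2 n, (N <= n)%N & f n = r.
Proof.
(* Requiring membership only from [N0] on lets the induction discard a value that is taken finitely
   often, at the cost of a larger threshold. *)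
suff H N0 : (forall n, (N0 <= n)%N -> f n \in s) ->
    exists2 r, r \in s & forall N, exists2 n, (N <= n)%N & f n = r.
  by move=> fs; apply: (H 0%N) => n _.
elim: s N0 => [N0 fs|y s IH N0 fs]; first by have := fs N0 (leqnn N0); rewrite in_nil.
have [yinf|/existsNP[N1 yN]] := pselect (forall N, exists2 n, (N <= n)%N & f n = y).
  by exists y; rewrite ?mem_head.
have [|r rs H] := IH (maxn N0 N1); last by exists r; rewrite // inE rs orbT.
move=> n; rewrite geq_max => /andP[n0 n1].
have := fs n n0; rewrite inE => /orP[/eqP fy|//].
by case: yN; exists n.
Qed.

(** * Growth of polynomials and of powers *)

Lemma norm_hornerMXaddC_ge (K : numFieldType) (p : {poly K}) (c e A w : K) :
  0 < e -> e <= `|p.[w]| -> (A + `|c|) / e <= `|w| ->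
  A <= `|(p * 'X + c%:P).[w]|.
Proof.
move=> e0 ew; rewrite ler_pdivrMr// => Aw.
rewrite hornerMXaddC -(lerD2r `|c|) (le_trans Aw)//.
rewrite (le_trans (ler_wpM2l _ ew))// mulrC -normrM.
by rewrite -{1}[p.[w] * w](addrK c) ler_normB.
Qed.

Lemma norm_horner_bounded_below (K : numFieldType) (p : {poly K}) : p != 0 ->
  exists e M, [/\ 0 < e, 0 <= M & forall w, M <= `|w| -> e <= `|p.[w]|].
Proof.
elim/poly_ind: p => [|p c IH pc0]; first by rewrite eqxx.
have [p0|/IH[e [M [e0 M0 H]]]] := eqVneq p 0.
  rewrite p0 mul0r add0r polyC_eq0 in pc0 *.
  by exists `|c|, 0; split=> [||w _]; rewrite ?normr_gt0 ?hornerC.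
have Me0 : 0 <= (1 + `|c|) / e by rewrite divr_ge0 ?addr_ge0// ltW.
exists 1, (M + (1 + `|c|) / e); split=> [||w Mw]; rewrite ?addr_ge0//.
apply: (@norm_hornerMXaddC_ge _ _ _ e) => //.
  by rewrite H// (le_trans _ Mw)// lerDl.
by rewrite (le_trans _ Mw)// lerDr.
Qed.

(** Degree at least 2 allows two Horner layers to be peeled off, leaving a nonzero [p], bounded
    below far out. The inner layer then has modulus at least 2, so the outer one is at least
    [2 * |w| - |c|], hence at least [|w|]. *)
Lemma horner_escape (K : numFieldType) (p : {poly K}) : (2 < size p)%N ->
  exists2 M, 0 <= M & forall w, M <= `|w| -> `|w| <= `|p.[w]|.
Proof.
have nz (q : {poly K}) c n : (n.+1 < size (q * 'X + c%:P)%R)%N -> (n < size q)%N.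
  by rewrite size_MXaddC; case: ifP.
elim/poly_ind: p => [|p c _ /nz]; first by rewrite size_poly0.
elim/poly_ind: p => [|p c1 _ /nz]; first by rewrite size_poly0.
rewrite size_poly_gt0 => /norm_horner_bounded_below[e [M [e0 M0 H]]].
(* The three summands of the radius serve the lower bound on [p], the inner layer and the outer
   layer respectively. *)
have Me0 : 0 <= (2 + `|c1|) / e by rewrite divr_ge0 ?addr_ge0// ltW.
exists (M + (2 + `|c1|) / e + `|c|) => [|w Mw]; first by rewrite !addr_ge0.
apply: (@norm_hornerMXaddC_ge _ _ _ 2) => //; last first.
  rewrite ler_pdivrMr// mulr_natr mulr2n lerD2l (le_trans _ Mw)// lerDr addr_ge0//.
apply: (@norm_hornerMXaddC_ge _ _ _ e) => //.
  by rewrite H// (le_trans _ Mw)// -addrA lerDl addr_ge0.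
by rewrite (le_trans _ Mw)// [leRHS]addrAC lerDr addr_ge0.
Qed.

Lemma exprn_ge2 (R : archiRealFieldType) (x : R) : 1 < x -> exists n, 2 <= x ^+ n.
Proof.
move=> x1; have y0 : 0 < x - 1 by rewrite subr_gt0.
(* Bernoulli's inequality; any [n] above [1 / (x - 1)] then suffices. *)
have bern n : 1 + (x - 1) *+ n <= x ^+ n.
  elim: n => [|n IH]; first by rewrite mulr0n addr0 expr0.
  rewrite exprS (le_trans _ (ler_wpM2l (ltW (lt_trans ltr01 x1)) IH))//.
  rewrite -subr_ge0 mulrS -mulr_natr; set m := n%:R.
  rewrite [X in 0 <= X](_ : _ = (x - 1) ^+ 2 * m).
    by rewrite mulr_ge0 ?sqr_ge0 ?ler0n.
  by rewrite expr2; ring.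
exists (Num.bound (x - 1)^-1); rewrite (le_trans _ (bern _))//.
rewrite -[2]/(1 + 1) lerD2l -mulr_natl -ler_pdivrMr// div1r ltW// archi_boundP//.
by rewrite invr_ge0 ltW.
Qed.

(** * Norm estimates and compactness in the complex plane *)

Section complex_plane.
Context {R : realType}.
Local Notation C := R[i].

Lemma normC_real (z : C) : `|z| = (complex.Re `|z|)%:C%C.
Proof. by rewrite normc_def. Qed.

Lemma normC_exprn_ge2 (z : C) : 1 < `|z| -> exists n, 2 <= `|z| ^+ n.
Proof.
rewrite normC_real => z1; have : 1 < complex.Re `|z| by rewrite -ltcR.
by move=> /exprn_ge2[n n2]; exists n; rewrite -rmorphXn -(rmorph_nat (real_complex R) 2) lecR.
Qed.

Lemma normC_le_nat (z : C) : exists n : nat, `|z| <= n%:R.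
Proof.
exists (Num.bound (complex.Re `|z|)).
rewrite [leLHS]normC_real -(rmorph_nat (real_complex R)) lecR.
by rewrite ltW// archi_boundP// -lecR -normC_real normr_ge0.
Qed.

Lemma normC_le_ReIm (x y : R) : `|(x +i* y)%C| <= (`|x| + `|y|)%:C%C.
Proof.
rewrite normc_def lecR -[leRHS]ger0_norm ?addr_ge0// -sqrtr_sqr ler_wsqrtr//=.
rewrite sqrrD !real_normK ?num_real// addrAC lerDl mulrn_wge0// mulr_ge0//.
Qed.

Lemma normC_ge_Im (z : C) : `|complex.Im z|%:C%C <= `|z|.
Proof. by rewrite normc_def lecR -sqrtr_sqr ler_wsqrtr// lerDr sqr_ge0. Qed.

(** The disk lies in the compact square of side [2 * M']; monotonicity in [n] lets finitely many
    local thresholds be replaced by one. *)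
Lemma disk_local_to_uniform (M : C) (Q : nat -> C -> Prop) :
  (forall m n z, (m <= n)%N -> Q m z -> Q n z) ->
  (forall z : C, exists2 d : C, 0 < d &
    exists n, forall w : C, `|w - z| < d -> Q n w) ->
  exists n, forall z : C, `|z| <= M -> Q n z.
Proof.
move=> Qmono Qloc; set M' := complex.Re M.
have := compact_setX (@segment_compact R (- M') M') (@segment_compact R (- M') M').
move=> /compact_near_coveringP /(_ nat \oo (fun n p => Q n (p.1 +i* p.2)%C) _).
case=> [[x y] _|N _ H]; last first.
  exists N => -[x y] xyM; apply: (H N _ (x, y)) => //=.
  split=> /=; rewrite in_itv/= -ler_norml.
    by have := le_trans (normc_ge_Re _) xyM; rewrite lecE => /andP[].
  by have := le_trans (normC_ge_Im _) xyM; rewrite lecE => /andP[].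
have [d d0 [n H]] := Qloc (x +i* y)%C.
(* Half of [d] for each coordinate, as the modulus is at most the sum of the coordinate
   distances. *)
pose e := complex.Re d / 2.
have e0 : 0 < e by move: d0; rewrite ltcE => /andP[_ ?]; rewrite divr_gt0.
exists (ball x e `*` ball y e, [set k | (n <= k)%N]) => /=.
  split; last by exists n.
  exists (ball x e, ball y e) => //=.
  by split; apply: nbhsx_ballx.
move=> [[x' y'] k] [[/= xx yy] nk]; apply: (Qmono _ _ _ nk); apply: H.
rewrite (le_lt_trans (normC_le_ReIm (x' - x) (y' - y)))//.
rewrite -(gtr0_norm d0) normC_real ltcR (gtr0_norm d0).
by rewrite [ltRHS]splitr ltrD// distrC.
Qed.

Lemma derivable_dist_lt (f : C -> C) (z : C) : derivable f z 1 ->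
  forall e : C, 0 < e ->
  exists2 d : C, 0 < d & forall x : C, `|x - z| < d -> `|f x - f z| < e.
Proof.
move=> /derivable1_diffP/differentiable_continuous/cvgrPdistC_lt fz e /fz[d /= d0 H].
by exists d => // x xz; apply: H; rewrite /ball_/= distrC.
Qed.

Lemma interior_dist (A : set C) (z : C) : interior A z ->
  exists2 d : C, 0 < d & forall x : C, `|x - z| < d -> A x.
Proof.
by move=> [d /= d0 H]; exists d => // x xz; apply: H; rewrite /ball_/= distrC.
Qed.

Lemma annulus_bounded (Psi : C -> C) (M : C) :
  (forall z, ext_disk z -> derivable Psi z 1) ->
  exists n : nat, forall z : C, 2 <= `|z| -> `|z| <= M -> `|Psi z| <= n%:R.
Proof.
move=> dPsi.
have [||n H] :=
  @disk_local_to_uniform M (fun n z => 2 <= `|z| -> `|Psi z| <= n%:R).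
- by move=> m n z mn H /H /le_trans; apply; rewrite ler_nat.
- move=> z; have [z2|z2] := real_leP (ger0_real (ler0n C 2)) (normr_real z).
    have [|d d0 H] := derivable_dist_lt _ _ (dPsi z _) _ ltr01.
      by rewrite /ext_disk/= (lt_le_trans _ z2)// ltr1n.
    have [n Hn] := normC_le_nat (`|Psi z| + 1).
    exists d => //; exists n => w /H wz _; rewrite (le_trans _ Hn)//.
    rewrite [leRHS]ger0_norm ?addr_ge0// -[Psi w](subrK (Psi z)) addrC.
    by rewrite (le_trans (ler_normD _ _))// lerD2l ltW.
  (* A point with [|z| < 2] has a neighbourhood that misses the annulus, so the guarded property
     holds there vacuously. *)
  exists (2 - `|z|); first by rewrite subr_gt0.
  exists 0%N => w wz w2; have := lt_le_trans wz (lerB w2 (lexx `|z|)).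
  by move=> /lt_le_trans/(_ (lerB_dist w z)); rewrite ltxx.
- by exists n => z z2 zM; exact: H.
Qed.

Lemma ext_diskX (z : C) n : (0 < n)%N -> ext_disk (z ^+ n) <-> ext_disk z.
Proof. by move=> n0; rewrite /ext_disk/= normrX expr_gt1. Qed.

(** * The Böttcher map and its impressions *)

Section bottcher_coordinate.
Variables (P : {poly C}) (Psi : C -> C).
Hypotheses (P2 : (2 <= (size P).-1)%N) (PsiP : bottcher P Psi).
Local Notation d := (size P).-1.

Lemma bottcher_iter (z : C) k : ext_disk z ->
  iter k (horner P) (Psi z) = Psi (z ^+ (d ^ k)).
Proof.
move=> z1; have [_ _ _ _ H] := PsiP; elim: k => [|k IH]; first by rewrite expn0 expr1.
rewrite iterS IH -H ?expnSr ?exprM//.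
by apply/ext_diskX => //; rewrite expn_gt0 (ltnW P2).
Qed.

(* A point [z] is moved by some [z ^+ (d ^ k)] into the annulus
   [2 <= |z| <= 2 ^ d], where [Psi] is bounded by compactness, whereas the
   orbit of a large [Psi z] would stay large. *)
Lemma bottcher_bounded :
  exists2 M : C, 0 <= M & forall z, ext_disk z -> `|z| <= 2 -> `|Psi z| <= M.
Proof.
have [dPsi _ _ _ _] := PsiP.
have [n Hn] := annulus_bounded _ (2 ^+ d) dPsi.
have [|M0 M00 esc] := horner_escape _ P; first by move: P2; case: (size P).
have M1 : 0 <= M0 + n%:R by rewrite addr_ge0.
exists (M0 + n%:R) => // z z1 z2.
have [//|Mz] := real_leP (normr_real (Psi z)) (ger0_real M1).
have grow k : `|Psi z| <= `|iter k (horner P) (Psi z)|.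
  elim: k => //= k IH; rewrite (le_trans IH)// esc// (le_trans _ IH)//.
  by rewrite (le_trans _ (ltW Mz))// lerDl.
have [|k k2 kmin] := @ex_minnP (fun k => 2 <= `|z| ^+ (d ^ k)).
  have [k k2] := normC_exprn_ge2 _ z1; exists k; rewrite (le_trans k2)//.
  by rewrite ler_weXn2l ?(ltW z1)// ltnW// ltn_expl.
(* If [k] is positive, minimality puts the preceding power below 2, so its [d]-th power is at most
   [2 ^+ d]; if [k = 0], [|z| <= 2] is enough. *)
have kd : `|z| ^+ (d ^ k) <= 2 ^+ d.
  case: k kmin {k2} => [_|k kmin].
    by rewrite expn0 expr1 (le_trans z2)// ler_eXnr ?ler1n// ltnW.
  rewrite expnSr exprM lerXn2r ?nnegrE ?exprn_ge0//.
  have [|//|/ltW/kmin] := real_leP _ (ger0_real (ler0n C 2)); last by rewrite ltnn.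
  by rewrite realX.
have := Hn (z ^+ (d ^ k)); rewrite normrX -bottcher_iter// => /(_ k2 kd).
move=> /(le_trans (grow k)) /(lt_le_trans Mz); rewrite gtrDr => /(le_lt_trans M00).
by rewrite ltxx.
Qed.

Lemma imp_sub_julia (zeta : C) : `|zeta| = 1 -> imp Psi zeta `<=` julia P.
Proof.
move=> zeta1 w [u [u1 uz uw]]; have [_ bPsi _ _ _] := PsiP; split.
  (* The limit [w] itself has bounded orbit: for each [k] the powers [u n ^+ (d ^ k)] tend to a
     point of modulus 1, so they eventually have modulus at most 2, with [M] independent of [k]. *)
  apply: subset_closure; have [M M0 H] := bottcher_bounded.
  exists M => k; apply: (cvg_norm_le _ _ _ _ (iter_horner_cvg _ P _ _ k uw) M0).
  have /cvg_seqP/(_ _ ltr01)[N HN] := horner_cvg _ 'X^(d ^ k) _ _ uz.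
  exists N => n Nn; rewrite /= bottcher_iter//; apply: H.
    by apply/ext_diskX => //; rewrite expn_gt0 (ltnW P2).
  have /= := HN n Nn; rewrite !hornerXn => un.
  rewrite -[_ ^+ _](subrK (zeta ^+ (d ^ k))) (le_trans (ler_normD _ _))//.
  by rewrite normrX zeta1 expr1n lerD2r ltW.
move=> /interior_dist[e e0 H]; have /cvg_seqP/(_ _ e0)[N HN] := uw.
exact: (bPsi _ (u1 N)) (H _ (HN N (leqnn N))).
Qed.

Lemma imp_horner (zeta : C) : horner P @` imp Psi zeta = imp Psi (zeta ^+ d).
Proof.
have [_ _ _ _ PsiE] := PsiP; have d0 : (0 < d)%N by rewrite ltnW.
apply/seteqP; split=> [_ [w [u [u1 uz uw]] <-]|w [v [v1 vz vw]]].
  exists (fun n => u n ^+ d); split.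
  - by move=> n; exact/ext_diskX.
  - have := horner_cvg _ 'X^d _ _ uz; rewrite hornerXn.
    by under [X in X @ _]funext do rewrite /= hornerXn.
  - have PsiX : horner P \o (Psi \o u) = Psi \o (fun n => u n ^+ d).
      by apply/funext => n /=; rewrite PsiE.
    by rewrite -PsiX; exact: horner_cvg.
(* The polynomial ['X^d - v n] takes the value [zeta ^+ d - v n] at [zeta], so [root_near] gives a
   [d]-th root of [v n] close to [zeta]. *)
have rt n : {r : C | r ^+ d = v n /\ `|r - zeta| ^+ d <= `|v n - zeta ^+ d|}.
  apply: cid; have [|r] := root_near _ ('X^d - (v n)%:P) zeta.
    by rewrite size_XnsubC.
  rewrite (eqP (monicXnsubC _ _))// normr1 mul1r size_XnsubC// /root !hornerE.
  by move=> /eqP/subr0_eq rv H; exists r; split=> //; rewrite distrC (le_trans H)// distrC.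
pose u n := sval (rt n).
have ud n : u n ^+ d = v n by case: (svalP (rt n)).
have uz : u @ \oo --> zeta.
  apply: (cvg_expn_dist _ d 1 _ _ _ _ ltr01 _ vz) => n; rewrite mul1r.
  by case: (svalP (rt n)).
have u1 n : ext_disk (u n) by apply/(ext_diskX _ _ d0); rewrite ud.
have sPw : size (P - w%:P) = size P.
  rewrite size_polyDl// size_polyN (leq_ltn_trans (size_polyC_leq1 _))//.
  by move: P2; case: (size P) => [|[]].
have lPw : 0 < `|lead_coef (P - w%:P)|.
  rewrite normr_gt0 lead_coef_eq0 -size_poly_gt0 sPw.
  by move: P2; case: (size P).
(* At [Psi (u n)] the polynomial [P - w] has the value [Psi (v n) - w], which tends to 0. *)
have rs n : {r : C | root (P - w%:P) r /\
    `|lead_coef (P - w%:P)| * `|Psi (u n) - r| ^+ d <= `|(Psi \o v) n - w|}.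
  apply: cid; have [|r rP H] := root_near _ (P - w%:P) (Psi (u n)).
    by rewrite sPw; move: P2; case: (size P) => [|[]].
  exists r; split=> //; rewrite sPw in H.
  by rewrite (le_trans H)// !hornerE /= -ud PsiE.
(* [P - w] has finitely many roots, so one of them is the nearby root for
   infinitely many [n]; this replaces a compactness argument. *)
have [s sP] := closed_field_poly_normal (P - w%:P).
have [n|r _ r_often] := infinite_pigeonhole _ s (fun n => sval (rs n)).
  have [+ _] := svalP (rs n); rewrite {1}sP rootZ ?root_prod_XsubC//.
  by rewrite -normr_gt0.
have /choice[m Hm] : forall N, exists n, (N <= n)%N /\ sval (rs n) = r.
  by move=> N; have [n] := r_often N; exists n.
have mE n : (n <= m n)%N by case: (Hm n).
exists r.
  exists (u \o m); split.
  - by move=> n; exact: u1.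
  - exact: cvg_reindex.
  - apply: (cvg_expn_dist _ d _ _ _ _ _ lPw _ (cvg_reindex _ _ _ _ mE vw)) => n.
    by have [_ rmn] := Hm n; have [_] := svalP (rs (m n)); rewrite rmn.
have [_ rm0] := Hm 0%N; have [+ _] := svalP (rs (m 0%N)).
by rewrite rm0 /root !hornerE => /eqP/subr0_eq.
Qed.

End bottcher_coordinate.
End complex_plane.

Theorem theorem4p3 (R : realType) (P : {poly R[i]}) (Psi phi g : R[i] -> R[i]) :
  (2 <= (size P).-1)%N ->
  connected (julia P) ->
  bottcher P Psi ->
  finest_monotone (julia P) phi ->
  plane_extension (julia P) phi ->
  branched_covering g ->
  (forall z, phi P.[z] = g (phi z)) ->
  forall zeta : R[i], `|zeta| = 1 ->
    Phi phi Psi zeta `<=` phi @` julia P /\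
    g @` Phi phi Psi zeta = Phi phi Psi (zeta ^+ (size P).-1).
Proof.
move=> P2 _ PsiP _ _ _ phiP zeta zeta1; split.
  exact/image_subset/imp_sub_julia.
rewrite /Phi -(imp_horner _ _ P2 PsiP) !image_comp.
by apply: eq_imagel => z _ /=; rewrite phiP.
Qed.
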